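(* Let $G$ be a finite group and $p\in\mathbb Z$ a prime dividing $|G|$. For each $n\geq 1$ let $\mathsf D_n$ be the full subcategory of $\mathrm{stmod}(\mathbb ZG)$ whose objects are the $\mathbb ZG$-modules isomorphic in $\mathrm{stmod}(\mathbb ZG)$ to modules annihilated by $p^n$. Then $\mathsf D_n\neq\mathsf D_{n+1}$ for each $n\geq1$, so these tensor ideal thick subcategories form a strictly increasing chain $$\mathsf D_1\subsetneq\mathsf D_2\subsetneq\mathsf D_3\subsetneq\cdots\subseteq\mathrm{stmod}(\mathbb ZG).$$ Moreover, the trivial module $\mathbb Z$ is not in $\mathsf D_n$ for any $n$, so $\bigcup_{n\geq1}\mathsf D_n$ is a proper thick subcategory of $\mathrm{stmod}(\mathbb ZG)$.
   Context: A short exact sequence of $\mathbb ZG$-modules is $\mathbb Z$-split exact if it splits over $\mathbb Z$. A $\mathbb ZG$-module $P$ is weakly projective if $\mathrm{Hom}_{\mathbb ZG}(P,-)$ preserves exactness of $\mathbb Z$-split exact sequences. $\mathrm{StMod}(\mathbb ZG)$ has as objects all $\mathbb ZG$-modules and as morphisms the $\mathbb ZG$-homomorphisms modulo those factoring through a weakly projective module; it is a triangulated category with triangles induced by $\mathbb Z$-split exact sequences, and a tensor triangulated category via $-\otimes_{\mathbb Z}-$ with diagonal $G$-action. $\mathrm{stmod}(\mathbb ZG)$ is the full (tensor triangulated) subcategory of objects isomorphic in $\mathrm{StMod}(\mathbb ZG)$ to finitely presented $\mathbb ZG$-modules. A thick subcategory $\mathsf C$ of $\mathrm{stmod}(\mathbb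 ZG)$ is tensor ideal if $M\otimes_{\mathbb Z}N\in\mathsf C$ for all $M\in\mathsf C$ and $N\in\mathrm{stmod}(\mathbb ZG)$. *)

(* Defs.v *)
From HB Require Import structures.
From mathcomp Require Import all_boot all_order all_algebra all_fingroup.
From mathcomp Require Import ring_quotient generic_quotient boolp.
From mathcomp.multinomials Require Import freeg.

Set Implicit Arguments.
Unset Strict Implicit.
Unset Printing Implicit Defensive.

Import GRing.Theory.
Local Open Scope ring_scope.
Local Open Scope quotient_scope.

(** * ZG-modules *)

(* A ZG-module is encoded as an abelian group with an action of G by group
   endomorphisms. No finiteness is imposed on the carrier; since classical
   choice is available, the choice operator inside [zmodType] is no
   restriction on the abelian group. *)
Record zgmod (G : finGroupType) := ZGMod {
  zgcar :> zmodType;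
  gact : G -> zgcar -> zgcar;
  gactB : forall g, zmod_morphism (gact g);
  gact1 : forall x, gact 1%g x = x;
  gactM : forall g h x, gact (g * h)%g x = gact g (gact h x) }.
Arguments gact {G M} g x : rename.
Arguments gactB {G M} g x y : rename.
Arguments gact1 {G M} x : rename.
Arguments gactM {G M} g h x : rename.

HB.instance Definition _ (G : finGroupType) (M : zgmod G) (g : G) :=
  GRing.isZmodMorphism.Build M M (@gact G M g) (@gactB G M g).

Record zghom (G : finGroupType) (M N : zgmod G) := ZGHom {
  zgfun :> M -> N;
  zghomB : zmod_morphism zgfun;
  zghomG : forall g x, zgfun (gact g x) = gact g (zgfun x) }.

HB.instance Definition _ (G : finGroupType) (M N : zgmod G) (f : zghom M N) :=
  GRing.isZmodMorphism.Build M N (zgfun f) (zghomB f).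

Section Category.
Variable G : finGroupType.

Lemma zgid_subproof (M : zgmod G) : zmod_morphism (fun x : M => x).
Proof. by []. Qed.

Definition zgid (M : zgmod G) : zghom M M :=
  @ZGHom G M M _ (@zgid_subproof M) (fun _ _ => erefl).

Lemma zgcompB (M N P : zgmod G) (g : zghom N P) (f : zghom M N) :
  zmod_morphism (fun x => g (f x)).
Proof. by move=> x y; rewrite !raddfB. Qed.

Lemma zgcompG (M N P : zgmod G) (g : zghom N P) (f : zghom M N) h x :
  g (f (gact h x)) = gact h (g (f x)).
Proof. by rewrite !zghomG. Qed.

Definition zgcomp (M N P : zgmod G) (g : zghom N P) (f : zghom M N) :
  zghom M P := ZGHom (zgcompB g f) (@zgcompG M N P g f).

End Category.

(** * Basic constructions *)

Section Constructions.
Variable G : finGroupType.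

Definition zgtriv : zgmod G.
Proof. by refine (@ZGMod G int (fun _ x => x) _ _ _). Defined.

Definition zgprod (M N : zgmod G) : zgmod G.
Proof.
refine (@ZGMod G (M * N)%type (fun g x => (gact g x.1, gact g x.2)) _ _ _).
- abstract by move=> g x y; rewrite /= !raddfB.
- abstract by case=> x y; rewrite /= !gact1.
- abstract by move=> g h x; rewrite /= !gactM.
Defined.

(* ZG as a left module: sum_h f(h) h is encoded by its coefficients f. *)
Definition zgreg : zgmod G.
Proof.
refine (@ZGMod G {ffun G -> int}
  (fun (g : G) f => [ffun h : G => f (g^-1 * h)%g]) _ _ _).
- abstract by move=> g f f'; apply/ffunP=> h; rewrite !ffunE.
- abstract by move=> f; apply/ffunP=> h; rewrite ffunE invg1 mul1g.
- abstract by move=> g g' f; apply/ffunP=> h; rewrite !ffunE invMg mulgA.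
Defined.

Definition zgfree (n : nat) : zgmod G.
Proof.
refine (@ZGMod G {ffun 'I_n -> zgreg}
  (fun g f => [ffun i => gact g (f i)]) _ _ _).
- abstract by move=> g f f'; apply/ffunP=> i; rewrite !ffunE raddfB.
- abstract by move=> f; apply/ffunP=> i; rewrite ffunE gact1.
- abstract by move=> g h f; apply/ffunP=> i; rewrite !ffunE gactM.
Defined.

(* Hom_Z(ZG, M) with (g f)(h) = f(hg); it only depends on the abelian group
   underlying M. *)
Definition zgcoind (M : zgmod G) : zgmod G.
Proof.
refine (@ZGMod G {ffun G -> M}
  (fun (g : G) f => [ffun h : G => f (h * g)%g]) _ _ _).
- abstract by move=> g f f'; apply/ffunP=> h; rewrite !ffunE.
- abstract by move=> f; apply/ffunP=> h; rewrite ffunE mulg1.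
- abstract by move=> g g' f; apply/ffunP=> h; rewrite !ffunE mulgA.
Defined.

Definition zgcoind_unit (M : zgmod G) : zghom M (zgcoind M).
Proof.
refine (@ZGHom G M (zgcoind M) (fun x => [ffun h => gact h x]) _ _).
- abstract by move=> x y; apply/ffunP=> h; rewrite !ffunE raddfB.
- abstract by move=> g x; apply/ffunP=> h; rewrite !ffunE gactM.
Defined.

Definition zgcoind_map (M N : zgmod G) (f : zghom M N) :
  zghom (zgcoind M) (zgcoind N).
Proof.
refine (@ZGHom G (zgcoind M) (zgcoind N)
  (fun u : {ffun G -> M} => [ffun h => f (u h)]) _ _).
- abstract by move=> u v; apply/ffunP=> h; rewrite !ffunE raddfB.
- abstract by move=> g u; apply/ffunP=> h; rewrite !ffunE.
Defined.

End Constructions.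
Arguments zgtriv {G}.

(** * Quotients *)

Record zgsub (G : finGroupType) (M : zgmod G) := ZGSub {
  zgmem : {pred M};
  zgsub_closed : zmod_closed zgmem;
  zgsubG : forall g x, x \in zgmem -> gact g x \in zgmem }.

HB.instance Definition _ (G : finGroupType) (M : zgmod G) (S : zgsub M) :=
  GRing.isZmodClosed.Build M (zgmem S) (zgsub_closed S).

Section Quotient.
Variables (G : finGroupType) (M : zgmod G) (S : zgsub M).

Local Notation Q := {ideal_quot (zgmem S)}.

Lemma zgquot_eq (x y : M) : (\pi_Q x = \pi_Q y) <-> (x - y \in zgmem S).
Proof.
by rewrite Quotient.idealrBE; split=> [xy|/eqP //]; apply/eqP.
Qed.

Definition zgquot_act (g : G) (t : Q) : Q := \pi_Q (gact g (repr t)).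

Lemma zgquot_actE g x : zgquot_act g (\pi_Q x) = \pi_Q (gact g x).
Proof.
by apply/zgquot_eq; rewrite -raddfB; apply/zgsubG/zgquot_eq; rewrite reprK.
Qed.

Definition zgquot : zgmod G.
Proof.
refine (@ZGMod G Q zgquot_act _ _ _).
- abstract by move=> g; elim/quotW=> x; elim/quotW=> y;
    rewrite -[\pi x - \pi y]raddfB !zgquot_actE !raddfB.
- abstract by elim/quotW=> x; rewrite zgquot_actE gact1.
- abstract by move=> g h; elim/quotW=> x;
    rewrite (zgquot_actE h) (zgquot_actE g) zgquot_actE gactM.
Defined.

Definition zgquot_pi : zghom M zgquot.
Proof.
refine (@ZGHom G M zgquot (fun x => \pi_Q x) _ _).
- abstract by move=> x y; rewrite raddfB.
- abstract by move=> g x; rewrite /= zgquot_actE.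
Defined.

Section Lift.
Variables (N : zgmod G) (f : zghom M N).
Hypothesis fS : forall x, x \in zgmem S -> f x = 0.

Lemma zgquot_liftE x : f (repr (\pi_Q x)) = f x.
Proof.
by apply/eqP; rewrite -subr_eq0 -(zghomB f) fS //; apply/zgquot_eq; rewrite reprK.
Qed.

Definition zgquot_lift : zghom zgquot N.
Proof.
refine (@ZGHom G zgquot N (fun t : Q => f (repr t)) _ _).
- abstract by elim/quotW=> x; elim/quotW=> y;
    rewrite -[\pi x - \pi y]raddfB !zgquot_liftE raddfB.
- abstract by move=> g; elim/quotW=> x;
    rewrite /= zgquot_actE !zgquot_liftE zghomG.
Defined.

End Lift.
End Quotient.

Definition zgim (G : finGroupType) (M N : zgmod G) (f : zghom M N) : zgsub N.
Proof.
refine (@ZGSub G N [pred y | `[< exists x, f x = y >]] _ _).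
- abstract (split=> [|y z];
    [by apply/asboolP; exists 0; rewrite raddf0
    |by move=> /asboolP[x <-] /asboolP[x' <-]; apply/asboolP;
       exists (x - x'); rewrite raddfB]).
- abstract by move=> g y /asboolP[x <-]; apply/asboolP;
    exists (gact g x); rewrite zghomG.
Defined.

(** * The tensor product over Z, with diagonal action *)

Section Tensor.
Variables (G : finGroupType) (M N : zgmod G).

Local Notation F := {freeg (M * N)%type / int}.

Lemma freeg_ext (K : choiceType) (V : zmodType) (f f' : {freeg K / int} -> V) :
  zmod_morphism f -> zmod_morphism f' ->
  (forall k, f << k >> = f' << k >>) -> f =1 f'.
Proof.
move=> fB f'B ff' D.
pose fA : {additive _ -> _} := HB.pack f (GRing.isZmodMorphism.Build _ _ _ fB).
pose f'A : {additive _ -> _} :=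
  HB.pack f' (GRing.isZmodMorphism.Build _ _ _ f'B).
rewrite -[f]/(fA : _ -> _) -[f']/(f'A : _ -> _).
rewrite -(freeg_sumE D) !raddf_sum; apply: eq_bigr => k _.
by rewrite -[coeff k D]intz -freegU_mulz !raddfMz /= ff'.
Qed.

Definition zgpairs_act (g : G) : F -> F :=
  fglift (fun mn => << (gact g mn.1, gact g mn.2) >> : F).

Lemma zgpairs_actB g : zmod_morphism (zgpairs_act g).
Proof. exact: lift_is_additive. Qed.

Lemma zgpairs_actU g m n : zgpairs_act g << (m, n) >> = << (gact g m, gact g n) >>.
Proof. by rewrite /zgpairs_act liftU scale1r. Qed.

(* The free abelian group on the set M x N, with diagonal action. *)
Definition zgpairs : zgmod G.
Proof.
refine (@ZGMod G F zgpairs_act zgpairs_actB _ _).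
- abstract (apply: freeg_ext => [||[m n]];
    [exact: zgpairs_actB | by [] | by rewrite zgpairs_actU !gact1]).
- abstract (move=> g h; apply: freeg_ext => [|x y|[m n]];
    [exact: zgpairs_actB | by rewrite !zgpairs_actB
    |by rewrite !zgpairs_actU !gactM]).
Defined.

Definition bilinear_rel (D : F) : Prop :=
  (exists m m' n, D = << (m + m', n) >> - << (m, n) >> - << (m', n) >>) \/
  (exists m n n', D = << (m, n + n') >> - << (m, n) >> - << (m, n') >>).

Definition bilinear_span : {pred F} := fun D =>
  `[< forall S : {pred F}, zmod_closed S ->
        (forall E, bilinear_rel E -> E \in S) -> D \in S >].

Lemma bilinear_span_closed : zmod_closed bilinear_span.
Proof.
split=> [|x y]; first by apply/asboolP=> S [S0 _] _.
move=> /asboolP Sx /asboolP Sy; apply/asboolP=> S SB SR.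
by apply: (SB.2); [apply: Sx | apply: Sy].
Qed.

Lemma bilinear_spanG g D :
  D \in bilinear_span -> zgpairs_act g D \in bilinear_span.
Proof.
have actB := zgpairs_actB g.
move=> /asboolP SD; apply/asboolP=> S [S0 SB] SR.
apply: (SD (fun E => zgpairs_act g E \in S)).
  split=> [|x y]; rewrite !unfold_in -/(_ \in S).
    by rewrite -(subr0 0) actB subrr.
  by move=> Sx Sy; rewrite actB; apply: SB.
move=> E ER; rewrite unfold_in; apply: SR.
case: ER => [[m [m' [n ->]]]|[m [n [n' ->]]]]; [left|right].
  exists (gact g m), (gact g m'), (gact g n).
  by rewrite !actB !zgpairs_actU raddfD.
exists (gact g m), (gact g n), (gact g n').
by rewrite !actB !zgpairs_actU raddfD.
Qed.

Definition zgpairs_rel : zgsub zgpairs :=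
  @ZGSub G zgpairs bilinear_span bilinear_span_closed bilinear_spanG.

Definition zgtensor : zgmod G := zgquot zgpairs_rel.

End Tensor.

(** * Z-split exactness and weakly projective modules *)

Section Exactness.
Variable G : finGroupType.

Definition short_exact (A B C : zgmod G) (f : zghom A B) (g : zghom B C) :=
  [/\ injective f,
      forall y, g y = 0 <-> exists x, f x = y &
      forall z, exists y, g y = z].

Definition zsplit_exact (A B C : zgmod G) (f : zghom A B) (g : zghom B C) :=
  short_exact f g /\ exists s : {additive C -> B}, cancel s g.

(* The three clauses say that
   0 -> Hom(P, A) -> Hom(P, B) -> Hom(P, C) -> 0 is exact. *)
Definition weakly_projective (P : zgmod G) :=
  forall (A B C : zgmod G) (f : zghom A B) (g : zghom B C),
    zsplit_exact f g ->
    [/\ forall a a' : zghom P A, zgcomp f a =1 zgcomp f a' -> a =1 a',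
        forall b : zghom P B,
          zgcomp g b =1 (fun=> 0) <-> exists a, zgcomp f a =1 b &
        forall c : zghom P C, exists b, zgcomp g b =1 c].

Definition finitely_presented (M : zgmod G) :=
  exists m n (r : zghom (zgfree G m) (zgfree G n)) (q : zghom (zgfree G n) M),
    (forall y, q y = 0 <-> exists x, r x = y) /\
    (forall z, exists y, q y = z).

End Exactness.

(** * The stable category *)

Section Stable.
Variable G : finGroupType.

(* Equality of morphisms in StMod(ZG). *)
Definition stable_eq (M N : zgmod G) (f f' : zghom M N) :=
  exists P (a : zghom M P) (b : zghom P N),
    weakly_projective P /\ forall x, f x - f' x = b (a x).

Definition stable_isom (M N : zgmod G) (f : zghom M N) :=
  exists f' : zghom N M,
    stable_eq (zgcomp f' f) (zgid M) /\ stable_eq (zgcomp f f') (zgid N).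

Definition stably_isomorphic (M N : zgmod G) :=
  exists f : zghom M N, stable_isom f.

Definition stmod (M : zgmod G) :=
  exists N, finitely_presented N /\ stably_isomorphic M N.

(* The suspension of X is the cokernel of the Z-split monomorphism
   X -> Hom_Z(ZG, X), whose target is weakly projective as G is finite. *)
Definition zgsusp (X : zgmod G) : zgmod G := zgquot (zgim (zgcoind_unit X)).

Definition zgsusp_pi (X : zgmod G) : zghom (zgcoind X) (zgsusp X) :=
  zgquot_pi (zgim (zgcoind_unit X)).

Lemma zgsusp_map_subproof (X Y : zgmod G) (f : zghom X Y) u :
  u \in zgmem (zgim (zgcoind_unit X)) ->
  zgcomp (zgsusp_pi Y) (zgcoind_map f) u = 0.
Proof.
move=> /asboolP[x <-]; rewrite -(raddf0 (zgsusp_pi Y)).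
apply/zgquot_eq; rewrite subr0; apply/asboolP; exists (f x).
by apply/ffunP=> h; rewrite !ffunE zghomG.
Qed.

Definition zgsusp_map (X Y : zgmod G) (f : zghom X Y) :
  zghom (zgsusp X) (zgsusp Y) := zgquot_lift (@zgsusp_map_subproof X Y f).

(* The third map is the connecting map of the Z-split exact sequence: it is
   induced by an extension k : Y -> Hom_Z(ZG, X) of the unit of X. *)
Definition standard_triangle (X Y Z : zgmod G)
    (f : zghom X Y) (g : zghom Y Z) (h : zghom Z (zgsusp X)) :=
  zsplit_exact f g /\
  exists k : zghom Y (zgcoind X),
    zgcomp k f =1 zgcoind_unit X /\ zgcomp h g =1 zgcomp (zgsusp_pi X) k.

Definition exact_triangle (X Y Z : zgmod G)
    (f : zghom X Y) (g : zghom Y Z) (h : zghom Z (zgsusp X)) :=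
  exists (X' Y' Z' : zgmod G)
    (f' : zghom X' Y') (g' : zghom Y' Z') (h' : zghom Z' (zgsusp X'))
    (a : zghom X X') (b : zghom Y Y') (c : zghom Z Z'),
    [/\ standard_triangle f' g' h',
        [/\ stable_isom a, stable_isom b & stable_isom c] &
        [/\ stable_eq (zgcomp b f) (zgcomp f' a),
            stable_eq (zgcomp c g) (zgcomp g' b) &
            stable_eq (zgcomp (zgsusp_map a) h) (zgcomp h' c)]].

(* Full subcategories of stmod(ZG) are given by predicates on objects. *)
Record thick (C : zgmod G -> Prop) : Prop := {
  thick_stmod : forall X, C X -> stmod X;
  thick_nonempty : exists X, C X;
  thick_iso : forall X Y, stably_isomorphic X Y -> C X -> C Y;
  thick_susp : forall X, stmod X -> (C (zgsusp X) <-> C X);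
  thick_triangle : forall X Y Z (f : zghom X Y) (g : zghom Y Z) h,
    stmod X -> stmod Y -> stmod Z -> @exact_triangle X Y Z f g h ->
    [/\ C X -> C Y -> C Z, C Y -> C Z -> C X & C X -> C Z -> C Y];
  thick_summand : forall X Y, stmod X -> stmod Y -> C (zgprod X Y) -> C X }.

Definition tensor_ideal (C : zgmod G -> Prop) :=
  forall M N, C M -> stmod N -> C (zgtensor M N).

Definition annihilated_by (m : nat) (M : zgmod G) := forall x : M, x *+ m = 0.

Definition Dn (p n : nat) (M : zgmod G) :=
  stmod M /\
  exists X, [/\ stmod X, annihilated_by (p ^ n) X & stably_isomorphic M X].

Definition union_Dn (p : nat) (M : zgmod G) :=
  exists2 n, (1 <= n)%N & Dn p n M.

End Stable.

(* Main.v *)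
(** A morphism of [ZG]-modules factors through a weakly projective module iff it
    is a trace, i.e. of the form [x |-> sum_g g u(g^-1 x)] with [u] additive.
    Consequently a module [M] of [stmod(ZG)] lies in [D_n] iff the identity of
    [M] is stably equal to an endomorphism [phi] with [p^n phi = 0]: then [phi]
    induces a stable inverse of the projection [M -> M/p^n M]. This criterion
    passes to stable retracts and to tensor products. In a Z-split exact
    sequence [A -> B -> C] with additive section [s] of [g : B -> C] and
    additive retraction [r] of [f : A -> B], if [1 + Tr(uA)] and [1 + Tr(uC)]
    are killed by [p^n] then so is [(1 + Tr(f uA r)) (1 + Tr(s uC g))]; the
    other two cases follow by rotation. On a module with trivial action the
    trace is multiplication by [|G|], so a prime [p] dividing [|G|] obstructs
    [Z/p^(n+1)] from lying in [D_n], and [Z] from lying in any [D_n]. *)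
From HB Require Import structures.
From mathcomp Require Import all_boot all_order all_algebra all_fingroup.
From mathcomp Require Import ring_quotient generic_quotient boolp.
From mathcomp.multinomials Require Import freeg.
(* Imported last because [action.v] also defines a [gact]. *)
Require Import Defs.

Set Implicit Arguments.
Unset Strict Implicit.
Unset Printing Implicit Defensive.

Import GRing.Theory.

(** * Traces and weakly projective modules *)

Section Trace.
Local Open Scope ring_scope.
Variable G : finGroupType.
Implicit Types A B C M N P X Y : zgmod G.

Definition ztr M N (u : M -> N) (x : M) : N :=
  \sum_(g : G) gact g (u (gact g^-1%g x)).

Lemma eq_ztr M N (u v : M -> N) : u =1 v -> ztr u =1 ztr v.
Proof. by move=> uv x; apply: eq_bigr => g _; rewrite uv. Qed.

(** Together with [ztr_compr]: composing a trace with an equivariant map on either side gives again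
    a trace, so traces behave as a two-sided ideal. *)
Lemma ztr_compl M N P (h : zghom N P) (u : M -> N) x :
  h (ztr u x) = ztr (h \o u) x.
Proof. by rewrite raddf_sum; apply: eq_bigr => g _; rewrite /= zghomG. Qed.

Lemma ztr_compr M N P (h : zghom M N) (u : N -> P) x :
  ztr u (h x) = ztr (u \o h) x.
Proof. by apply: eq_bigr => g _; rewrite /= zghomG. Qed.

Lemma ztrB M N (u : {additive M -> N}) : zmod_morphism (ztr u).
Proof.
by move=> x y; rewrite -sumrB; apply: eq_bigr => g _; rewrite !raddfB.
Qed.

Lemma ztrG M N (u : M -> N) h x : ztr u (gact h x) = gact h (ztr u x).
Proof.
rewrite raddf_sum [LHS](reindex_inj (mulgI h)); apply: eq_bigr => g _ /=.
by rewrite -!gactM invMg mulgKV.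
Qed.

Definition zgtr M N (u : {additive M -> N}) : zghom M N :=
  ZGHom (ztrB u) (ztrG u).

(** * Sums and differences of homomorphisms *)

Lemma zgaddB M N (f g : zghom M N) : zmod_morphism (fun x => f x + g x).
Proof. exact: (raddfB (f \+ g)). Qed.

Lemma zgaddG M N (f g : zghom M N) h x :
  f (gact h x) + g (gact h x) = gact h (f x + g x).
Proof. by rewrite !zghomG raddfD. Qed.

Definition zgadd M N (f g : zghom M N) : zghom M N :=
  ZGHom (zgaddB f g) (@zgaddG M N f g).

Lemma zgoppB M N (f : zghom M N) : zmod_morphism (fun x => - f x).
Proof. by move=> x y; rewrite raddfB opprD. Qed.

Lemma zgoppG M N (f : zghom M N) h x : - f (gact h x) = gact h (- f x).
Proof. by rewrite zghomG raddfN. Qed.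

Definition zgopp M N (f : zghom M N) : zghom M N :=
  ZGHom (zgoppB f) (@zgoppG M N f).

Definition zgsubr M N (f g : zghom M N) := zgadd f (zgopp g).

(** * Factorisations through short exact sequences *)

Lemma additiveP (U V : zmodType) (f : U -> V) :
  zmod_morphism f -> exists u : {additive U -> V}, u =1 f.
Proof.
move=> fB.
by exists (HB.pack f (GRing.isZmodMorphism.Build _ _ _ fB) : {additive U -> V}).
Qed.

Lemma zghom_lift A B C (f : zghom A B) (g : zghom B C) X (h : zghom X B) :
  short_exact f g -> (forall x, g (h x) = 0) ->
  exists k : zghom X A, forall x, f (k x) = h x.
Proof.
move=> [fI fg _] gh0.
have /choice[k kE] x : exists a, f a = h x by apply/fg.
have kB : zmod_morphism k by move=> x y; apply: fI; rewrite zghomB !kE zghomB.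
have kG g' x : k (gact g' x) = gact g' (k x).
  by apply: fI; rewrite zghomG !kE zghomG.
by exists (ZGHom kB kG).
Qed.

Lemma zghom_factor A B C (f : zghom A B) (g : zghom B C) X (h : zghom B X) :
  short_exact f g -> (forall x, h (f x) = 0) ->
  exists k : zghom C X, forall x, k (g x) = h x.
Proof.
move=> [_ fg gS] hf0.
have hI x y : g x = g y -> h x = h y.
  move=> /eqP; rewrite -subr_eq0 -zghomB => /eqP /fg[z zE].
  by apply/eqP; rewrite -subr_eq0 -zghomB -zE hf0.
have /choice[t tE] := gS.
have hg x : h (t (g x)) = h x by apply: hI.
have kB : zmod_morphism (h \o t).
  move=> x y; rewrite /= -zghomB; apply: hI.
  by rewrite zghomB !tE.
have kG g' x : (h \o t) (gact g' x) = gact g' ((h \o t) x).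
  by rewrite /= -zghomG; apply: hI; rewrite zghomG !tE.
by exists (ZGHom kB kG).
Qed.

Lemma zsplit_retraction A B C (f : zghom A B) (g : zghom B C)
    (s : {additive C -> B}) :
  short_exact f g -> cancel s g ->
  exists r : {additive B -> A}, cancel f r /\
    forall b, f (r b) = b - s (g b).
Proof.
move=> [fI fg _] sK.
have /choice[r rE] b : exists a, f a = b - s (g b).
  by apply/fg; rewrite zghomB sK subrr.
have /additiveP[r' r'E] : zmod_morphism r.
  by move=> x y; apply: fI; rewrite zghomB !rE zghomB raddfB !opprD addrACA.
exists r'; split=> [a|b]; last by rewrite r'E.
apply: fI; rewrite r'E rE.
have -> : g (f a) = 0 by apply/fg; exists a.
by rewrite raddf0 subr0.
Qed.

(** A map [c] out of [P] has the additive lift [s \o c]. Averaging [s \o c \o u] makes the lift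
    equivariant, and [g] sends it to the trace of [c \o u], which is [c] composed with the trace of
    [u], that is, [c]. *)
Lemma ztr_weakly_projective P (u : {additive P -> P}) :
  ztr u =1 id -> weakly_projective P.
Proof.
move=> u1 A B C f g [fgE [s sK]]; have [fI fg gS] := fgE; split.
- by move=> a a' faa' x; apply/fI/faa'.
- move=> b; split=> [gb0|[a aE] x].
    by have [a aE] := zghom_lift fgE gb0; exists a.
  by rewrite /= -aE; apply/fg; exists (a x).
- move=> c.
  exists (zgtr (s \o c \o u)) => x.
  rewrite /= ztr_compl -[RHS](congr1 c (u1 x)) ztr_compl.
  by apply: eq_ztr => y /=; rewrite sK.
Qed.

(** * Submodules and kernels *)

Section Submodule.
Variables (M : zgmod G) (S : zgsub M).

Definition submod_car := {x : M | x \in zgmem S}.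
HB.instance Definition _ := SubChoice.on submod_car.
HB.instance Definition _ := [SubChoice_isSubZmodule of submod_car by <:].

Definition submod_act g (x : submod_car) : submod_car :=
  Sub (gact g (val x)) (zgsubG g (valP x)).

Lemma submod_actB g : zmod_morphism (submod_act g).
Proof. by move=> x y; apply: val_inj; rewrite /= !raddfB. Qed.

Lemma submod_act1 x : submod_act 1%g x = x.
Proof. by apply: val_inj; rewrite /= gact1. Qed.

Lemma submod_actM g h x : submod_act (g * h)%g x = submod_act g (submod_act h x).
Proof. by apply: val_inj; rewrite /= gactM. Qed.

Definition zgsubmod : zgmod G := ZGMod submod_actB submod_act1 submod_actM.

Lemma submod_valB : zmod_morphism (val : zgsubmod -> M).
Proof. exact: raddfB. Qed.

Definition zgsubmod_val : zghom zgsubmod M :=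
  @ZGHom G zgsubmod M (val : zgsubmod -> M) submod_valB (fun _ _ => erefl).
End Submodule.

Definition zgker M N (f : zghom M N) : zgsub M.
Proof.
refine (@ZGSub G M [pred x | f x == 0] _ _).
- abstract (split=> [|x y]; rewrite !inE ?raddf0 ?zghomB //;
    by move=> /eqP-> /eqP->; rewrite subr0).
- abstract by move=> g x; rewrite !inE zghomG => /eqP->; rewrite raddf0.
Defined.

Lemma zgker_exact M N (f : zghom M N) :
  (forall y, exists x, f x = y) -> short_exact (zgsubmod_val (zgker f)) f.
Proof.
move=> fS; split=> //; first exact: val_inj.
move=> y; split=> [fy0|[[x /= /eqP fx0] <-]//].
by have yK : y \in zgmem (zgker f) by [apply/eqP]; exists (Sub y yK).
Qed.

(** As [G] is finite, the coinduced module is also induced: the function supported at [h] with value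
    [m] stands for [h^-1 ⊗ m]. The sum is then the action map to [M]. *)
Definition zgcounit M : zgcoind M -> M :=
  fun v : {ffun G -> M} => \sum_h gact h^-1%g (v h).

Lemma zgcounitB M : zmod_morphism (@zgcounit M).
Proof.
move=> v w; rewrite -sumrB; apply: eq_bigr => h _.
by rewrite -raddfB !ffunE.
Qed.

Lemma zgcounitG M g (v : zgcoind M) : zgcounit (gact g v) = gact g (zgcounit v).
Proof.
rewrite raddf_sum [RHS](reindex_inj (mulIg g)); apply: eq_bigr => h _.
by rewrite /= ffunE -gactM invMg mulgA mulgV mul1g.
Qed.

Definition zgcoind_counit M : zghom (zgcoind M) M :=
  ZGHom (@zgcounitB M) (@zgcounitG M).

Definition delta1 (V : zmodType) (x : V) : {ffun G -> V} :=
  [ffun h => if h == 1%g then x else 0].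

Lemma delta1B (V : zmodType) : zmod_morphism (@delta1 V).
Proof.
by move=> x y; apply/ffunP=> h; rewrite !ffunE; case: ifP; rewrite ?subr0.
Qed.

Lemma counit_delta1 M : cancel (@delta1 M) (@zgcoind_counit M).
Proof.
move=> x; rewrite /= /zgcounit (bigD1 1%g) //= big1 => [|h /negPf h1].
  by rewrite ffunE eqxx invg1 gact1 addr0.
by rewrite ffunE h1 raddf0.
Qed.

(** Here [u] keeps only the value at [1]. Its conjugate by [g] keeps only the value at [g^-1], so
    the conjugates add up to the identity. *)
Lemma coind_ztr M : exists u : {additive zgcoind M -> zgcoind M}, ztr u =1 id.
Proof.
have /additiveP[u uE] :
    zmod_morphism (fun v : zgcoind M => delta1 (v 1%g) : zgcoind M).
  by move=> v w; rewrite !ffunE delta1B.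
exists u => v; apply/ffunP=> h; rewrite /ztr sum_ffunE.
rewrite (bigD1 h^-1%g) //= big1 => [|g gh]; rewrite !(uE, ffunE).
  by rewrite mulgV eqxx invgK mul1g addr0.
by rewrite -eq_invg_mul eq_sym (negPf gh).
Qed.

(** The counit from [zgcoind P] is split additively by [delta1], so weak projectivity lifts the
    identity of [P] along it. The identity then factors through a module whose own identity is a
    trace. *)
Lemma weakly_projective_ztr P :
  weakly_projective P -> exists u : {additive P -> P}, ztr u =1 id.
Proof.
move=> wP; have [d dE] := additiveP (@delta1B P).
have dK : cancel (d : P -> zgcoind P) (zgcoind_counit P).
  by move=> x; rewrite dE counit_delta1.
have ex := zgker_exact (fun y => ex_intro _ _ (dK y)).
have [_ _ /(_ (zgid P))[b bE]] := wP _ _ _ _ _ (conj ex (ex_intro _ d dK)).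
have [w w1] := coind_ztr P.
exists (zgcoind_counit P \o w \o b) => x.
rewrite -[RHS]bE /= -[in RHS](w1 (b x)) ztr_compr.
by rewrite -[zgcounit _]/(zgcoind_counit P _) ztr_compl; apply: eq_ztr.
Qed.

Lemma coind_weakly_projective M : weakly_projective (zgcoind M).
Proof. by have [u u1] := coind_ztr M; apply: ztr_weakly_projective u1. Qed.

(** A map through a weakly projective module is a trace because the identity of that module is one.
    Conversely the trace of [u] is the map sending [x] to the function [h |-> u(hx)], followed by
    the counit of [N]. *)
Lemma stable_eqP M N (f f' : zghom M N) :
  stable_eq f f' <->
  exists u : {additive M -> N}, forall x, f x - f' x = ztr u x.
Proof.
split=> [[P [a [b [/weakly_projective_ztr[w w1] ff']]]]|[u uE]].
  exists (b \o w \o a) => x.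
  by rewrite ff' -(w1 (a x)) ztr_compr ztr_compl; apply: eq_ztr.
have kB : zmod_morphism (fun x : M => [ffun h => u (gact h x)] : zgcoind N).
  by move=> x y; apply/ffunP=> h; rewrite !ffunE !raddfB.
have kG h x : [ffun h' => u (gact h' (gact h x))] =
    gact h ([ffun h' => u (gact h' x)] : zgcoind N).
  by apply/ffunP=> h'; rewrite !ffunE gactM.
exists (zgcoind N), (ZGHom kB kG), (zgcoind_counit N).
split=> [|x]; first exact: coind_weakly_projective.
rewrite uE /= /zgcounit [LHS](reindex_inj invg_inj).
by apply: eq_bigr => h _; rewrite ffunE invgK.
Qed.

End Trace.

(** * Stable annihilation *)

Section Stable.
Local Open Scope ring_scope.
Variable G : finGroupType.
Implicit Types A B C M N P X Y : zgmod G.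

(** * Stable equality as a congruence, and stable isomorphism *)

Lemma stable_eq_ext M N (f f' g g' : zghom M N) :
  f =1 f' -> g =1 g' -> stable_eq f g -> stable_eq f' g'.
Proof.
move=> ff' gg' /stable_eqP[u uE]; apply/stable_eqP; exists u => x.
by rewrite -ff' -gg'.
Qed.

Lemma stable_eq_refl M N (f : zghom M N) : stable_eq f f.
Proof.
apply/stable_eqP; exists (\0 : {additive M -> N}) => x.
by rewrite subrr /ztr big1 // => g _; rewrite raddf0.
Qed.

Lemma stable_eq_eqfun M N (f f' : zghom M N) : f =1 f' -> stable_eq f f'.
Proof.
by move=> ff'; apply: stable_eq_ext (fun=> erefl) ff' _; apply: stable_eq_refl.
Qed.

Lemma ztr_add M N (u v : M -> N) x : ztr (u \+ v) x = ztr u x + ztr v x.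
Proof. by rewrite -big_split; apply: eq_bigr => g _; rewrite /= raddfD. Qed.

Lemma ztr_opp M N (u : M -> N) x : ztr (\- u) x = - ztr u x.
Proof. by rewrite -sumrN; apply: eq_bigr => g _; rewrite /= raddfN. Qed.

Lemma ztrMn_eq0 M N (u : M -> N) m x :
  (forall y, u y *+ m = 0) -> ztr u x *+ m = 0.
Proof.
by move=> um; rewrite -sumrMnl big1 // => g _; rewrite -raddfMn /= um raddf0.
Qed.

Lemma stable_eq_sym M N (f f' : zghom M N) : stable_eq f f' -> stable_eq f' f.
Proof.
move=> /stable_eqP[u uE]; apply/stable_eqP; exists (\- u) => x.
by rewrite ztr_opp -uE opprB.
Qed.

Lemma stable_eq_trans M N (f' f f'' : zghom M N) :
  stable_eq f f' -> stable_eq f' f'' -> stable_eq f f''.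
Proof.
move=> /stable_eqP[u uE] /stable_eqP[v vE]; apply/stable_eqP.
by exists (u \+ v) => x; rewrite ztr_add -uE -vE addrA subrK.
Qed.

Lemma stable_eq_compl M N P (h : zghom N P) (f f' : zghom M N) :
  stable_eq f f' -> stable_eq (zgcomp h f) (zgcomp h f').
Proof.
move=> /stable_eqP[u uE]; apply/stable_eqP; exists (h \o u) => x.
by rewrite /= -zghomB uE ztr_compl.
Qed.

Lemma stable_eq_compr M N P (h : zghom M N) (f f' : zghom N P) :
  stable_eq f f' -> stable_eq (zgcomp f h) (zgcomp f' h).
Proof.
move=> /stable_eqP[u uE]; apply/stable_eqP; exists (u \o h) => x.
by rewrite /= uE ztr_compr.
Qed.

Lemma stably_isomorphic_refl M : stably_isomorphic M M.
Proof. by exists (zgid M), (zgid M); split; apply: stable_eq_refl. Qed.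

Lemma stably_isomorphic_sym M N :
  stably_isomorphic M N -> stably_isomorphic N M.
Proof. by move=> [f [f' [f'f ff']]]; exists f', f. Qed.

Lemma stable_retract_trans M N P (i : zghom M N) (r : zghom N M)
    (j : zghom N P) (q : zghom P N) :
  stable_eq (zgcomp r i) (zgid M) -> stable_eq (zgcomp q j) (zgid N) ->
  stable_eq (zgcomp (zgcomp r q) (zgcomp j i)) (zgid M).
Proof.
move=> ri qj; apply: stable_eq_trans ri.
exact: (stable_eq_compl r (stable_eq_compr i qj)).
Qed.

Lemma stably_isomorphic_trans N M P :
  stably_isomorphic M N -> stably_isomorphic N P -> stably_isomorphic M P.
Proof.
move=> [f [f' [f'f ff']]] [g [g' [g'g gg']]].
exists (zgcomp g f), (zgcomp f' g').
by split; apply: stable_retract_trans.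
Qed.

Lemma stmod_isom M N : stably_isomorphic M N -> stmod M -> stmod N.
Proof.
move=> MN [P [fpP MP]]; exists P; split=> //.
exact: stably_isomorphic_trans (stably_isomorphic_sym MN) MP.
Qed.

Lemma finitely_presented_stmod M : finitely_presented M -> stmod M.
Proof. by exists M; split=> //; apply: stably_isomorphic_refl. Qed.

(** The equation [m phi = 0] is strict, not stable: on the trivial module [Z], multiplication by
    [|G|] is a trace and so stably zero, yet no nonzero endomorphism is killed by a positive
    integer. *)
Definition stably_annihilated (m : nat) M :=
  exists phi : zghom M M,
    stable_eq phi (zgid M) /\ forall x, phi x *+ m = 0.

Lemma annihilated_stably m M : annihilated_by m M -> stably_annihilated m M.
Proof. by move=> mM; exists (zgid M); split; [apply: stable_eq_refl|]. Qed.

Lemma stably_annihilated_retract m M N (i : zghom M N) (r : zghom N M) :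
  stable_eq (zgcomp r i) (zgid M) ->
  stably_annihilated m N -> stably_annihilated m M.
Proof.
move=> ri [phi [phi1 phim]]; exists (zgcomp r (zgcomp phi i)); split.
  apply: stable_eq_trans ri.
  exact: (stable_eq_compl r (stable_eq_compr i phi1)).
by move=> x; rewrite /= -raddfMn /= phim raddf0.
Qed.

Lemma stably_annihilated_isom m M N :
  stably_isomorphic M N -> stably_annihilated m N -> stably_annihilated m M.
Proof. by move=> [f [f' [f'f _]]]; apply: stably_annihilated_retract f'f. Qed.

(** * The quotient [M/mM] *)

Definition zgmultiples (m : nat) M : zgsub M.
Proof.
refine (@ZGSub G M [pred x | `[< exists y, x = y *+ m >]] _ _).
- abstract (split=> [|x y];
    [by apply/asboolP; exists 0; rewrite mul0rn
    |by move=> /asboolP[x' ->] /asboolP[y' ->]; apply/asboolP;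
       exists (x' - y'); rewrite mulrnBl]).
- abstract by move=> g x /asboolP[y ->]; apply/asboolP;
    exists (gact g y); rewrite raddfMn.
Defined.

Lemma zgquot_ind M (S : zgsub M) (Q : zgquot S -> Prop) :
  (forall x, Q (zgquot_pi S x)) -> forall t, Q t.
Proof. by move=> QS; elim/quotW=> x; apply: QS. Qed.

Lemma zgquot_pi_eq0 M (S : zgsub M) x :
  zgquot_pi S x = 0 <-> x \in zgmem S.
Proof. by rewrite -(raddf0 (zgquot_pi S)) zgquot_eq subr0. Qed.

Lemma zgquot_additive M (S : zgsub M) (V : zmodType) (f : {additive M -> V}) :
  (forall x, x \in zgmem S -> f x = 0) ->
  exists k : {additive zgquot S -> V}, forall x, k (zgquot_pi S x) = f x.
Proof.
move=> fS; pose k (t : zgquot S) := f (repr t).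
have kE x : k (zgquot_pi S x) = f x.
  apply/eqP; rewrite -subr_eq0 -raddfB fS //.
  by apply/zgquot_eq; rewrite reprK.
have /additiveP[k' k'E] : zmod_morphism k.
  by elim/zgquot_ind=> x; elim/zgquot_ind=> y; rewrite -zghomB !kE raddfB.
by exists k' => x; rewrite k'E.
Qed.

(** Since [phi] kills [mM], it descends to a map from [M/mM] to [M]. One composite with the
    projection is [phi] itself; the other is the map induced by [phi] on the quotient. *)
Lemma stably_isomorphic_quot_multiples m M :
  stably_annihilated m M -> stably_isomorphic M (zgquot (zgmultiples m M)).
Proof.
move=> [phi [phi1 phim]]; set S := zgmultiples m M.
have phiS x : x \in zgmem S -> phi x = 0.
  by move=> /asboolP[y ->]; rewrite raddfMn phim.
exists (zgquot_pi S), (zgquot_lift phiS); split.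
  by apply: stable_eq_ext phi1 => // x; rewrite /= zgquot_liftE.
have /stable_eqP[u uE] := phi1.
(* An additive map preserves [mM], so [u] descends to [v] on the quotient, and the trace of [v] is
   what [phi] minus the identity induces there. *)
have uS x : x \in zgmem S -> (zgquot_pi S \o u) x = 0.
  move=> /asboolP[y ->]; rewrite /comp raddfMn.
  by apply/zgquot_pi_eq0/asboolP; exists (u y).
have [v vE] := zgquot_additive uS.
apply/stable_eqP; exists v; elim/zgquot_ind=> x.
rewrite ztr_compr (eq_ztr vE) -ztr_compl -uE zghomB /=.
by rewrite zgquot_liftE.
Qed.

Lemma quot_multiples_annihilated m M :
  annihilated_by m (zgquot (zgmultiples m M)).
Proof.
elim/zgquot_ind=> x; rewrite -raddfMn.
by apply/zgquot_pi_eq0/asboolP; exists x.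
Qed.

Lemma DnP p n M : Dn p n M <-> stmod M /\ stably_annihilated (p ^ n) M.
Proof.
split=> [[stM [X [_ annX MX]]]|[stM annM]].
  split=> //; apply: stably_annihilated_isom MX _.
  exact: annihilated_stably.
have MQ := stably_isomorphic_quot_multiples annM.
split=> //; exists (zgquot (zgmultiples (p ^ n) M)); split=> //.
  exact: stmod_isom stM.
exact: quot_multiples_annihilated.
Qed.

(** [PA] extends [pA] along [f] and [PC] lifts [pC] along [g], both stably the identity. Multiplying
    [PC] by [m] pushes its values into [m A], which [PA] then kills. *)
Lemma stably_annihilated_ext m A B C (f : zghom A B) (g : zghom B C) :
  zsplit_exact f g ->
  stably_annihilated m A -> stably_annihilated m C -> stably_annihilated m B.
Proof.
move=> [ex [s sK]] [pA [/stable_eqP[uA uAE] pA0]] [pC [/stable_eqP[uC uCE] pC0]].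
have [r [fK fr]] := zsplit_retraction ex sK.
pose PA := zgadd (zgid B) (zgtr (f \o uA \o r)).
pose PC := zgadd (zgid B) (zgtr (s \o uC \o g)).
have PA1 : stable_eq PA (zgid B).
  by apply/stable_eqP; exists (f \o uA \o r) => x; rewrite /= addrC addKr.
have PC1 : stable_eq PC (zgid B).
  by apply/stable_eqP; exists (s \o uC \o g) => x; rewrite /= addrC addKr.
have PAf a : PA (f a) = f (pA a).
  rewrite /= ztr_compr -[pA a](subrK a) uAE raddfD /= addrC; congr (_ + _).
  by rewrite ztr_compl; apply: eq_ztr => x /=; rewrite fK.
have gPC b : g (PC b) = pC (g b).
  rewrite /= raddfD /= ztr_compl -[pC _](subrK (g b)) uCE addrC.
  congr (_ + _); rewrite ztr_compr; apply: eq_ztr => x /=.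
  by rewrite sK.
exists (zgcomp PA PC); split.
  by apply: stable_eq_trans PC1; apply: (stable_eq_compr PC PA1).
(* The part [s (g (PC b))] equals [s (pC (g b))] and is killed by [m], leaving only the part in the
   image of [f]. *)
move=> b; have Pb : PC b *+ m = f (r (PC b) *+ m).
  rewrite raddfMn /= fr gPC mulrnBl -[s _ *+ m]raddfMn pC0.
  by rewrite raddf0 subr0.
rewrite (_ : _ *+ m = PA (PC b *+ m)); last by rewrite raddfMn.
by rewrite Pb PAf raddfMn pA0 raddf0.
Qed.

(** [pC] lifts to an endomorphism [Phi] of [P] killed by [m], and [Phi] restricts to [pA] on [A].
    Subtracting the identity and the trace of [s \o uC \o g] from [Phi] leaves a map with values in
    [A]. *)
Lemma stably_annihilated_sub m A P C (f : zghom A P) (g : zghom P C) :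
  zsplit_exact f g -> weakly_projective P ->
  stably_annihilated m C -> stably_annihilated m A.
Proof.
move=> [ex [s sK]] wP [pC [/stable_eqP[uC uCE] pC0]].
have [w w1] := weakly_projective_ztr wP.
have [_ fg _] := ex.
have gf a : g (f a) = 0 by apply/fg; exists a.
(* A lift of [pC] to [P] with values killed by [m], as [pC] factors through
   the additive map [s \o pC]. *)
pose Phi := zgtr (s \o pC \o g \o w).
have gPhi x : g (Phi x) = pC (g x).
  rewrite /= ztr_compl -[in RHS](w1 x) ztr_compl ztr_compl.
  by apply: eq_ztr => y /=; rewrite sK.
have Phim x : Phi x *+ m = 0.
  by apply: ztrMn_eq0 => y; rewrite /= -raddfMn pC0 raddf0.
have [pA pAE] : exists k : zghom A A, forall x, f (k x) = zgcomp Phi f x.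
  by apply: zghom_lift ex _ => x; rewrite /= gPhi gf raddf0.
exists pA; split; last first.
  by move=> x; have [fI _ _] := ex; apply: fI; rewrite raddfMn /= pAE Phim raddf0.
have [psi psiE] : exists k : zghom P A, forall x,
    f (k x) = zgsubr (zgsubr Phi (zgid P)) (zgtr (s \o uC \o g)) x.
  apply: zghom_lift ex _ => x; rewrite zghomB zghomB gPhi /=.
  apply/eqP; rewrite subr_eq0 uCE ztr_compl ztr_compr; apply/eqP.
  by apply: eq_ztr => y /=; rewrite sK.
(* The trace term vanishes on the image of [f], so [psi] after [f] is [pA] minus the identity, which
   thus factors through [P]. *)
exists P, f, psi; split=> // x; have [fI _ _] := ex; apply: fI.
rewrite psiE zghomB pAE /= [X in _ = _ - X]big1 ?subr0 // => h _.
by rewrite /= -zghomG gf !raddf0.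
Qed.

(** Dual to the previous argument: [Phi] extends [pA] to [P], is killed by [m] and induces [pC] on
    the cokernel. Subtracting the identity and the trace of [f \o uA \o r] gives a map vanishing on
    [A], hence a map [chi] from [C] to [P] through which [pC] minus the identity factors. *)
Lemma stably_annihilated_quotient m A P C (f : zghom A P) (g : zghom P C) :
  zsplit_exact f g -> weakly_projective P ->
  stably_annihilated m A -> stably_annihilated m C.
Proof.
move=> [ex [s sK]] wP [pA [/stable_eqP[uA uAE] pA0]].
have [w w1] := weakly_projective_ztr wP.
have [r [fK fr]] := zsplit_retraction ex sK.
have [_ fg gS] := ex.
have gf a : g (f a) = 0 by apply/fg; exists a.
pose Phi := zgtr (w \o f \o pA \o r).
have Phif a : Phi (f a) = f (pA a).
  rewrite /= ztr_compr -[RHS]w1 ztr_compr ztr_compr.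
  by apply: eq_ztr => y /=; rewrite fK.
have Phim x : Phi x *+ m = 0.
  apply: ztrMn_eq0 => y.
  by rewrite /= -[X in X = _]raddfMn /= -raddfMn pA0 !raddf0.
have [pC pCE] : exists k : zghom C C, forall x, k (g x) = zgcomp g Phi x.
  by apply: zghom_factor ex _ => x; rewrite -[LHS]/(g (Phi (f x))) Phif gf.
exists pC; split; last first.
  by move=> z; have [y <-] := gS z; rewrite pCE /= -raddfMn /= Phim raddf0.
have [chi chiE] : exists k : zghom C P, forall x,
    k (g x) = zgsubr (zgsubr Phi (zgid P)) (zgtr (f \o uA \o r)) x.
  apply: zghom_factor ex _ => x.
  rewrite -[LHS]/(Phi (f x) - f x - ztr (f \o uA \o r) (f x)) Phif.
  apply/eqP; rewrite subr_eq0 -zghomB uAE ztr_compl ztr_compr; apply/eqP.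
  by apply: eq_ztr => y /=; rewrite fK.
exists P, chi, g; split=> // z; have [y <-] := gS z.
rewrite chiE pCE.
rewrite -[zgsubr _ _ _]/(Phi y - y - ztr (f \o uA \o r) y) !zghomB.
rewrite ztr_compl [X in _ = _ - X]big1 ?subr0 // => h _.
by rewrite /= gf !raddf0.
Qed.

End Stable.

(** * Suspension and rotation *)

Section Suspension.
Local Open Scope ring_scope.
Variable G : finGroupType.
Implicit Types A B C M N P X Y : zgmod G.

Lemma zghomD M N (f : zghom M N) x y : f (x + y) = f x + f y.
Proof. exact: raddfD. Qed.

Lemma zgsusp_pi_eq0 X v :
  zgsusp_pi X v = 0 <-> exists x, zgcoind_unit X x = v.
Proof.
split=> [/zgquot_pi_eq0/asboolP//|xv].
by apply/zgquot_pi_eq0/asboolP.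
Qed.

Lemma zgsusp_pi_unit X x : zgsusp_pi X (zgcoind_unit X x) = 0.
Proof. by apply/zgsusp_pi_eq0; exists x. Qed.

Lemma zgcoind_unit_inj X : injective (zgcoind_unit X).
Proof. by move=> x y /ffunP/(_ 1%g); rewrite !ffunE !gact1. Qed.

Lemma zgsusp_zsplit X : zsplit_exact (zgcoind_unit X) (zgsusp_pi X).
Proof.
split; first split.
- exact: zgcoind_unit_inj.
- exact: zgsusp_pi_eq0.
- by elim/zgquot_ind=> v; exists v.
(* Evaluation at [1] is an additive retraction of the unit; the complementary projection kills the
   image of the unit and descends to a section. *)
have /additiveP[w wE] :
    zmod_morphism (fun v : zgcoind X => v - zgcoind_unit X (v 1%g)).
  by move=> v v'; rewrite !ffunE raddfB !opprD addrACA.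
have w0 v : v \in zgmem (zgim (zgcoind_unit X)) -> w v = 0.
  move=> /asboolP[x <-]; rewrite wE; apply/eqP; rewrite subr_eq0; apply/eqP.
  by congr (zgcoind_unit X _); rewrite ffunE gact1.
have [s sE] := zgquot_additive w0.
exists s; elim/zgquot_ind=> v; rewrite sE wE zghomB.
by rewrite [X in _ - X]zgsusp_pi_unit subr0.
Qed.

Lemma stably_annihilated_susp m X :
  stably_annihilated m (zgsusp X) <-> stably_annihilated m X.
Proof.
have wX := coind_weakly_projective X; have ex := zgsusp_zsplit X.
by split; [apply: stably_annihilated_sub|apply: stably_annihilated_quotient];
  try exact: wX; exact: ex.
Qed.

(** * Products and their stable retracts *)

Definition zgfst M N : zghom (zgprod M N) M :=
  @ZGHom G (zgprod M N) M fst (fun _ _ => erefl) (fun _ _ => erefl).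

Definition zgsnd M N : zghom (zgprod M N) N :=
  @ZGHom G (zgprod M N) N snd (fun _ _ => erefl) (fun _ _ => erefl).

Section Pair.
Variables (X M N : zgmod G) (f : zghom X M) (g : zghom X N).

Lemma zgpairB : zmod_morphism (fun x => (f x, g x) : zgprod M N).
Proof. by move=> x y; rewrite !zghomB. Qed.

Lemma zgpairG h x :
  (f (gact h x), g (gact h x)) = gact h ((f x, g x) : zgprod M N).
Proof. by rewrite !zghomG. Qed.

Definition zgpair : zghom X (zgprod M N) := ZGHom zgpairB zgpairG.
End Pair.

Lemma zgzeroB M N : zmod_morphism (fun _ : M => 0 : N).
Proof. by move=> x y; rewrite subrr. Qed.

Lemma zgzeroG M N h (x : M) : 0 = gact h (0 : N).
Proof. by rewrite raddf0. Qed.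

Definition zgzero M N : zghom M N := ZGHom (@zgzeroB M N) (@zgzeroG M N).

Lemma stably_annihilated_fst m M N :
  stably_annihilated m (zgprod M N) -> stably_annihilated m M.
Proof.
apply: (@stably_annihilated_retract _ _ _ _ (zgpair (zgid M) (zgzero M N))
  (zgfst M N)).
exact: stable_eq_eqfun.
Qed.

Lemma stably_annihilated_snd m M N :
  stably_annihilated m (zgprod M N) -> stably_annihilated m N.
Proof.
apply: (@stably_annihilated_retract _ _ _ _ (zgpair (zgzero N M) (zgid N))
  (zgsnd M N)).
exact: stable_eq_eqfun.
Qed.

Lemma stably_annihilated_prod_wproj m P N : weakly_projective P ->
  stably_annihilated m N -> stably_annihilated m (zgprod P N).
Proof.
move=> wP.
apply: (@stably_annihilated_retract _ _ _ _ (zgsnd P N)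
  (zgpair (zgzero N P) (zgid N))).
apply: stable_eq_sym.
exists P, (zgfst P N), (zgpair (zgid P) (zgzero P N)); split=> //.
by case=> x y; congr pair; rewrite /= ?subr0 ?subrr.
Qed.

(* The rotated triangle [B -> C -> susp A], made Z-split exact by adding the
   weakly projective summand [zgcoind A] to [C]. *)
Lemma rotate A B C (f : zghom A B) (g : zghom B C) :
  zsplit_exact f g ->
  exists (i : zghom B (zgprod (zgcoind A) C))
    (q : zghom (zgprod (zgcoind A) C) (zgsusp A)), zsplit_exact i q.
Proof.
move=> [ex [s sK]]; have [r [fK fr]] := zsplit_retraction ex sK.
have [fI fg gS] := ex.
(* The additive retraction [r] corresponds to an equivariant map [k] into the coinduced module,
   which extends the unit of [A] along [f]. *)
have kB : zmod_morphism (fun b : B => [ffun h => r (gact h b)] : zgcoind A).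
  by move=> x y; apply/ffunP=> h; rewrite !ffunE !raddfB.
have kG h b : [ffun h' => r (gact h' (gact h b))] =
    gact h ([ffun h' => r (gact h' b)] : zgcoind A).
  by apply/ffunP=> h'; rewrite !ffunE gactM.
pose k : zghom B (zgcoind A) := ZGHom kB kG.
have kf a : k (f a) = zgcoind_unit A a.
  by apply/ffunP=> h; rewrite !ffunE -zghomG fK.
(* [l] is the connecting map of the sequence; the kernel of [q] below is the pullback of
   [zgsusp_pi A] and [l]. *)
have [l lE] : exists l : zghom C (zgsusp A),
    forall b, l (g b) = zgcomp (zgsusp_pi A) k b.
  by apply: zghom_factor ex _ => a; rewrite -[LHS]/(zgsusp_pi A (k (f a))) kf
    zgsusp_pi_unit.
have [[uI upi piS] [t tK]] := zgsusp_zsplit A.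
pose q := zgsubr (zgcomp (zgsusp_pi A) (zgfst (zgcoind A) C))
  (zgcomp l (zgsnd (zgcoind A) C)).
have qE v c : q (v, c) = zgsusp_pi A v - l c by [].
exists (zgpair k g), q; split; first split.
- move=> b b' [kbb' gbb']; apply/eqP; rewrite -subr_eq0; apply/eqP.
  have /fg[a aE] : g (b - b') = 0 by rewrite zghomB gbb' subrr.
  rewrite -aE; suff -> : a = 0 by rewrite raddf0.
  apply: uI; rewrite -kf aE zghomB -[k b]/([ffun h => _]) kbb' subrr.
  by rewrite raddf0.
- move=> [v c]; rewrite qE; split=> [|[b [<- <-]]]; last first.
    by apply/eqP; rewrite subr_eq0 lE.
  (* Any preimage [b] of [c] has [k b] equal to [v] up to some [zgcoind_unit A a]; correcting [b] by
     [f a] fixes the first component and leaves [g b] unchanged. *)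
  have [b <-] := gS c; move=> /eqP; rewrite lE -zghomB => /eqP/upi[a aE].
  exists (b + f a); rewrite -[LHS]/(k (b + f a), g (b + f a)) !zghomD kf aE.
  have -> : g (f a) = 0 by apply/fg; exists a.
  by rewrite addr0 addrC subrK.
- move=> z; have [v <-] := piS z; exists (v, 0).
  by rewrite qE raddf0 subr0.
- have /additiveP[t' t'E] :
      zmod_morphism (fun z => (t z, 0) : zgprod (zgcoind A) C).
    by move=> x y; rewrite raddfB -[X in (_, X)](subrr (0 : C)).
  by exists t' => z; rewrite t'E qE raddf0 subr0 tK.
Qed.

(** After rotation, [C] is a summand of an extension of [zgsusp A] by [B]. *)
Lemma stably_annihilated_cone m A B C (f : zghom A B) (g : zghom B C) :
  zsplit_exact f g ->
  stably_annihilated m A -> stably_annihilated m B -> stably_annihilated m C.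
Proof.
move=> /rotate[i [q ex]] /stably_annihilated_susp mA mB.
exact: stably_annihilated_snd (stably_annihilated_ext ex mB mA).
Qed.

(** The rotated sequence exhibits [zgsusp A] as the cone of a map from [B] to [C] plus a weakly
    projective summand. *)
Lemma stably_annihilated_fibre m A B C (f : zghom A B) (g : zghom B C) :
  zsplit_exact f g ->
  stably_annihilated m B -> stably_annihilated m C -> stably_annihilated m A.
Proof.
move=> /rotate[i [q ex]] mB mC; apply/stably_annihilated_susp.
apply: stably_annihilated_cone ex mB _.
by apply: stably_annihilated_prod_wproj mC; apply: coind_weakly_projective.
Qed.

(** * Suspension on stable classes of maps *)

Lemma zgsusp_mapE X Y (f : zghom X Y) v :
  zgsusp_map f (zgsusp_pi X v) = zgsusp_pi Y (zgcoind_map f v).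
Proof. exact: (zgquot_liftE (@zgsusp_map_subproof G X Y f)). Qed.

(** A map through a weakly projective module extends along the Z-split unit of [X]. This extension
    corrects the difference of the coinduced maps so that it descends to [zgsusp X], and the
    difference of the suspensions then factors through [zgcoind Y]. *)
Lemma zgsusp_map_stable X Y (f f' : zghom X Y) :
  stable_eq f f' -> stable_eq (zgsusp_map f) (zgsusp_map f').
Proof.
move=> [P [a [b [wP ff']]]].
have [w w1] := weakly_projective_ztr wP.
have [ex [s sK]] := zgsusp_zsplit X.
(* [e] extends [f - f'] along the unit of [X] *)
have [r [uK _]] := zsplit_retraction ex sK.
pose e := zgcomp b (zgtr (w \o a \o r)).
have eu x : e (zgcoind_unit X x) = f x - f' x.
  rewrite ff' -[in RHS](w1 (a x)).
  rewrite -[LHS]/(b (ztr (w \o a \o r) (zgcoind_unit X x))).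
  rewrite ztr_compr ztr_compr; congr (b _).
  by apply: eq_ztr => y; rewrite /= uK.
pose D := zgsubr (zgsubr (zgcoind_map f) (zgcoind_map f'))
  (zgcomp (zgcoind_unit Y) e).
have [d dE] : exists d : zghom (zgsusp X) (zgcoind Y),
    forall v, d (zgsusp_pi X v) = D v.
  apply: zghom_factor ex _ => x; apply/eqP; rewrite subr_eq0; apply/eqP.
  rewrite -[zgcomp _ _ _]/(zgcoind_unit Y (e (zgcoind_unit X x))) eu.
  by apply/ffunP=> h; rewrite !ffunE /= !raddfB /= !zghomG.
exists (zgcoind Y), d, (zgsusp_pi Y).
split; first exact: coind_weakly_projective.
elim/zgquot_ind=> v.
rewrite dE !(zghomB (zgsusp_pi Y)) [X in _ = _ - X]zgsusp_pi_unit subr0.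
by rewrite !zgsusp_mapE.
Qed.

Lemma stably_isomorphic_susp X Y :
  stably_isomorphic X Y -> stably_isomorphic (zgsusp X) (zgsusp Y).
Proof.
have comp1 M N (f : zghom M N) (f' : zghom N M) :
    stable_eq (zgcomp f' f) (zgid M) ->
    stable_eq (zgcomp (zgsusp_map f') (zgsusp_map f)) (zgid (zgsusp M)).
  move=> /zgsusp_map_stable; apply: stable_eq_ext; elim/zgquot_ind=> v.
    rewrite zgsusp_mapE -[RHS]/(zgsusp_map f' (zgsusp_map f (zgsusp_pi M v))).
    rewrite !zgsusp_mapE; congr (zgsusp_pi M _).
    by apply/ffunP=> h; rewrite !ffunE.
  rewrite zgsusp_mapE; congr (zgsusp_pi M _).
  by apply/ffunP=> h; rewrite !ffunE.
by move=> [f [f' [/comp1 f'f /comp1 ff']]]; exists (zgsusp_map f), (zgsusp_map f').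
Qed.

End Suspension.

(** * Finite presentation *)

Section FinitelyGenerated.
Local Open Scope ring_scope.

Definition subgroup (V : zmodType) (S : V -> Prop) :=
  S 0 /\ forall x y, S x -> S y -> S (x - y).

Lemma subgroupD (V : zmodType) (S : V -> Prop) x y :
  subgroup S -> S x -> S y -> S (x + y).
Proof.
move=> [S0 SB] Sx Sy; rewrite -[y]opprK; apply: (SB) => //.
by rewrite -[- y]add0r; apply: SB.
Qed.

Lemma subgroup_mulz (V : zmodType) (S : V -> Prop) x (c : int) :
  subgroup S -> S x -> S (x *~ c).
Proof.
move=> gS Sx; have Sn n : S (x *+ n).
  elim: n => [|n IHn]; first by rewrite mulr0n; case: gS.
  by rewrite mulrS; apply: subgroupD.
case: c => n; first exact: Sn.
by rewrite NegzE mulrNz -[- _]add0r; case: gS => S0 SB; apply: SB => //; apply: Sn.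
Qed.

Lemma subgroup_sum (V : zmodType) (S : V -> Prop) (I : Type) (r : seq I) F :
  subgroup S -> (forall i, S (F i)) -> S (\sum_(i <- r) F i).
Proof.
move=> gS SF; apply: big_ind => // [|x y]; first by case: gS.
exact: subgroupD.
Qed.

(** The recursion peels off one generator with its coefficient, which suits induction on the number
    of generators. *)
Fixpoint zspan (V : zmodType) (s : seq V) (x : V) : Prop :=
  if s is v :: s' then exists c : int, zspan s' (x - v *~ c) else x = 0.

Lemma zspan_subgroup (V : zmodType) (s : seq V) : subgroup (zspan s).
Proof.
elim: s => [|v s [s0 sB]]; first by split=> //= x y -> ->; rewrite subr0.
split=> [|x y [c xc] [d yd]] /=; first by exists 0; rewrite mulr0z subr0.
exists (c - d); suff -> : x - y - v *~ (c - d) = (x - v *~ c) - (y - v *~ d).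
  exact: sB.
by rewrite mulrzBr !opprD addrACA.
Qed.

Lemma zspan_mem (V : zmodType) (s : seq V) x : x \in s -> zspan s x.
Proof.
elim: s => //= v s IHs; rewrite inE => /predU1P[->|/IHs xs].
  by exists 1; rewrite mulr1z subrr; case: (zspan_subgroup s).
by exists 0; rewrite mulr0z subr0.
Qed.

Lemma zspan_min (V : zmodType) (s : seq V) (S : V -> Prop) :
  subgroup S -> (forall x, x \in s -> S x) -> forall x, zspan s x -> S x.
Proof.
move=> gS; elim: s => [|v s IHs] sS x /=; first by move->; case: gS.
move=> [c xc]; rewrite -[x](subrK (v *~ c)); apply: subgroupD => //.
  by apply: IHs xc => y ys; apply: sS; rewrite inE ys orbT.
by apply: subgroup_mulz => //; apply: sS; rewrite mem_head.
Qed.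

Lemma int_subgroup (S : int -> Prop) : subgroup S ->
  exists d, S d /\ forall c, S c -> exists q, c = q * d.
Proof.
move=> gS; have [S0 SB] := gS.
(* Positive integers are written [n.+1]. If none lies in [S], closure under negation leaves only
   [0], and [d = 0] generates; otherwise the least one does, by Euclidean division. *)
have [[n Sn]|noS] := pselect (exists n : nat, `[< S n.+1%:Z >]); last first.
  exists 0; split=> // c Sc; exists 0; rewrite mul0r.
  have SNc : S (- c) by rewrite -[- c]add0r; apply: SB.
  case: c Sc SNc => [[//|n]|n] Sc SNc; case: noS; exists n; apply/asboolP => //.
have exS : exists n, (fun n : nat => `[< S n.+1%:Z >]) n by exists n.
have [m /asboolP Sm mmin] := ex_minnP exS.
exists m.+1%:Z; split=> // c Sc; exists (c %/ m.+1%:Z)%Z.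
have Sr : S (c %% m.+1%:Z)%Z.
  rewrite /modz; apply: SB => //.
  by rewrite mulrC -mulrzz; apply: subgroup_mulz.
rewrite [LHS](divz_eq c m.+1%:Z).
case rE : (c %% m.+1%:Z)%Z Sr => [[|k]|k] Sr; first by rewrite addr0.
  have := mmin k (introT (asboolP _) Sr).
  have : ((c %% m.+1%:Z)%Z < m.+1%:Z) by rewrite ltz_pmod.
  by rewrite rE ltz_nat ltnS ltnNge => /negPf->.
by have := @modz_ge0 c m.+1%:Z isT; rewrite rE.
Qed.

(** The coefficients of [v] modulo [zspan s] occurring in [S] form a subgroup of the integers with
    generator [d]. An element [xd] of [S] realising [d], with generators of the intersection of [S]
    and [zspan s], generates [S]. *)
Lemma zspan_noetherian (V : zmodType) (s : seq V) (S : V -> Prop) :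
  subgroup S -> (forall x, S x -> zspan s x) ->
  exists t, forall x, S x <-> zspan t x.
Proof.
elim: s S => [|v s IHs] S gS Ss.
  by exists [::] => x; split=> [/Ss//|/= ->]; case: gS.
have gs := zspan_subgroup s; have [S0 SB] := gS; have [s0 sB] := gs.
have [|d [[xd [Sxd xdd]] dP]] :=
    @int_subgroup (fun c => exists x, S x /\ zspan s (x - v *~ c)).
  split=> [|c c' [x [Sx xc]] [y [Sy yc]]].
    by exists 0; rewrite mulr0z subr0.
  exists (x - y); split; first exact: SB.
  suff -> : x - y - v *~ (c - c') = (x - v *~ c) - (y - v *~ c') by apply: sB.
  by rewrite mulrzBr !opprD addrACA.
have [| |t tP] := IHs (fun x => S x /\ zspan s x).
- by split=> [//|x y [Sx xs] [Sy ys]]; split; [apply: SB | apply: sB].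
- by move=> x [].
exists (xd :: t) => x; split=> [Sx|[q /tP[Sx _]]]; last first.
  rewrite -[x](subrK (xd *~ q)); apply: subgroupD => //.
  exact: subgroup_mulz.
have [c xc] := Ss x Sx.
have [|q cq] := dP c; first by exists x.
exists q; apply/tP; split; first by apply: SB => //; apply: subgroup_mulz.
suff -> : x - xd *~ q = (x - v *~ c) - (xd - v *~ d) *~ q.
  by apply: sB => //; apply: subgroup_mulz.
by rewrite mulrzBl -mulrzA [d * q]mulrC -cq opprB addrA subrK.
Qed.

Definition finitely_generated (V : zmodType) :=
  exists s : seq V, forall x, zspan s x.

Lemma finitely_generated_surj (V W : zmodType) (f : {additive V -> W}) :
  (forall y, exists x, f x = y) ->
  finitely_generated V -> finitely_generated W.
Proof.
move=> fS [s sP]; exists (map f s) => y; have [x <-] := fS y.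
apply: (@zspan_min V s (fun x => zspan (map f s) (f x))) => // {x y}.
  have [f0 fB] := zspan_subgroup (map f s).
  by split=> [|x y fx fy]; rewrite ?raddf0 // raddfB; apply: fB.
by move=> x xs; apply/zspan_mem/map_f.
Qed.

Lemma finitely_generated_int : finitely_generated int.
Proof. by exists [:: 1] => x; exists x; rewrite /= intz subrr. Qed.

Lemma finitely_generated_ffun (I : finType) (V : zmodType) :
  finitely_generated V -> finitely_generated {ffun I -> V}.
Proof.
move=> [s sP]; pose d (i : I) (v : V) := [ffun j => if j == i then v else 0].
pose t := [seq d i v | i <- enum I, v <- s]; exists t => x.
have gt := zspan_subgroup t; have [t0 tB] := gt.
have -> : x = \sum_(i : I) d i (x i).
  apply/ffunP=> j; rewrite sum_ffunE (bigD1 j) //= ffunE eqxx big1 ?addr0 //.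
  by move=> i /negPf ij; rewrite ffunE eq_sym ij.
apply: subgroup_sum => // i.
apply: (@zspan_min V s (fun v => zspan t (d i v))) => // [|v vs].
  split=> [|v w tv tw].
    suff -> : d i 0 = 0 by [].
    by apply/ffunP=> j; rewrite !ffunE if_same.
  suff -> : d i (v - w) = d i v - d i w by apply: tB.
  by apply/ffunP=> j; rewrite !ffunE; case: ifP; rewrite ?subr0.
by apply/zspan_mem/allpairsP; exists (i, v); rewrite mem_enum.
Qed.

Variable G : finGroupType.
Implicit Types M N : zgmod G.

(** * Maps out of free modules *)

Section FreeMap.
Variables (n : nat) (M : zgmod G) (e : 'I_n -> M).

Definition zgfree_fun (f : zgfree G n) : M :=
  \sum_i \sum_h gact h (e i) *~ (f : {ffun 'I_n -> zgreg G}) i h.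

Lemma zgfree_funB : zmod_morphism zgfree_fun.
Proof.
move=> f f'; rewrite -sumrB; apply: eq_bigr => i _.
by rewrite -sumrB; apply: eq_bigr => h _; rewrite !ffunE mulrzBr.
Qed.

Lemma zgfree_funG g f : zgfree_fun (gact g f) = gact g (zgfree_fun f).
Proof.
rewrite raddf_sum; apply: eq_bigr => i _.
rewrite raddf_sum /= (reindex_inj (mulgI g)); apply: eq_bigr => h _.
by rewrite !ffunE mulKg raddfMz /= gactM.
Qed.

Definition zgfree_map : zghom (zgfree G n) M := ZGHom zgfree_funB zgfree_funG.

Lemma zgfree_map_gen i : exists f, zgfree_map f = e i.
Proof.
exists ([ffun j => [ffun h => (if (j == i) && (h == 1%g) then 1 else 0) : int]]).
rewrite /= /zgfree_fun (bigD1 i) //= (bigD1 1%g) //= !ffunE !eqxx mulr1z gact1.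
rewrite !big1 ?addr0 // => [j /negPf ij|h /negPf h1].
  by rewrite big1 // => h _; rewrite !ffunE ij mulr0z.
by rewrite !ffunE h1 andbF mulr0z.
Qed.
End FreeMap.

Lemma zgfree_map_im M (s : seq M) x :
  zspan s x -> exists f, zgfree_map (fun i : 'I_(size s) => s`_i) f = x.
Proof.
apply: (zspan_min (S := fun x => exists f,
  zgfree_map (fun i : 'I_(size s) => s`_i) f = x)) => [|y ys].
  split=> [|y z [f <-] [f' <-]]; first by exists 0; rewrite raddf0.
  by exists (f - f'); rewrite raddfB.
have ys' : (index y s < size s)%N by rewrite index_mem.
have [f fE] := zgfree_map_gen (fun i : 'I_(size s) => s`_i) (Ordinal ys').
by exists f; rewrite fE /= nth_index.
Qed.

(** As [G] is finite, [zgfree G n] is finitely generated as an abelian group, so the kernel of a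
    surjection from it is too; additive generators of the kernel serve as relations. *)
Lemma finitely_presentedP M : finitely_presented M <-> finitely_generated M.
Proof.
have fgF n : finitely_generated (zgfree G n).
  by do 2!apply: finitely_generated_ffun; apply: finitely_generated_int.
split=> [[m [n [r [q [_ qS]]]]]|[s sP]].
  exact: finitely_generated_surj qS (fgF n).
have [q qS] : exists q : zghom (zgfree G (size s)) M, forall z, exists f, q f = z.
  exists (zgfree_map (fun i : 'I_(size s) => s`_i)) => z.
  exact: zgfree_map_im.
have [s' s'P] := fgF (size s).
have [|t tP] := @zspan_noetherian _ s' (fun y => q y = 0) _ (fun x _ => s'P x).
  by split=> [|y z y0 z0]; rewrite ?raddf0 // zghomB y0 z0 subr0.
exists (size t), (size s), (zgfree_map (fun i : 'I_(size t) => t`_i)), q.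
split=> // y.
split=> [/tP/zgfree_map_im//|[f <-]].
rewrite [zgfree_map _ f]/= /zgfree_fun raddf_sum big1 // => i _.
rewrite raddf_sum big1 // => h _; rewrite raddfMz /= zghomG.
have /tP -> : zspan t t`_i by apply/zspan_mem/mem_nth.
by rewrite raddf0 mul0rz.
Qed.

Lemma finitely_generated_stmod M : finitely_generated M -> stmod M.
Proof. by move=> /finitely_presentedP/finitely_presented_stmod. Qed.

Lemma stmod_isom_fg M : stmod M ->
  exists2 N : zgmod G, finitely_generated N & stably_isomorphic M N.
Proof. by move=> [N [/finitely_presentedP fgN MN]]; exists N. Qed.

Lemma finitely_generated_quot M (S : zgsub M) :
  finitely_generated M -> finitely_generated (zgquot S).
Proof.
apply: (finitely_generated_surj (f := zgquot_pi S)).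
by elim/zgquot_ind=> x; exists x.
Qed.

Lemma stmod_susp M : stmod M -> stmod (zgsusp M).
Proof.
move=> /stmod_isom_fg[N fgN /stably_isomorphic_susp MN].
apply: stmod_isom (stably_isomorphic_sym MN) _.
by apply/finitely_generated_stmod/finitely_generated_quot/finitely_generated_ffun.
Qed.

End FinitelyGenerated.

(** * Tensor products *)

Section Tensor.
Local Open Scope ring_scope.
Variable G : finGroupType.
Implicit Types M N : zgmod G.

(** * Pure tensors and induced maps *)

Definition tens M N (x : M) (y : N) : zgtensor M N :=
  zgquot_pi (zgpairs_rel M N) << (x, y) >>.

Lemma tens_act M N g (x : M) (y : N) :
  gact g (tens x y) = tens (gact g x) (gact g y).
Proof. by rewrite -zghomG /= zgpairs_actU. Qed.

Lemma tensDl M N (x x' : M) (y : N) : tens (x + x') y = tens x y + tens x' y.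
Proof.
apply/eqP; rewrite -subr_eq0 opprD addrA -!zghomB; apply/eqP/zgquot_pi_eq0.
by apply/asboolP=> S _; apply; left; exists x, x', y.
Qed.

Lemma tensDr M N (x : M) (y y' : N) : tens x (y + y') = tens x y + tens x y'.
Proof.
apply/eqP; rewrite -subr_eq0 opprD addrA -!zghomB; apply/eqP/zgquot_pi_eq0.
by apply/asboolP=> S _; apply; right; exists x, y, y'.
Qed.

Lemma tensBl M N (y : N) : zmod_morphism (fun x : M => tens x y).
Proof. by move=> x x'; apply/eqP; rewrite eq_sym subr_eq -tensDl subrK. Qed.

Lemma tensBr M N (x : M) : zmod_morphism (fun y : N => tens x y).
Proof. by move=> y y'; apply/eqP; rewrite eq_sym subr_eq -tensDr subrK. Qed.

Lemma tens_suml M N (I : Type) (r : seq I) (F : I -> M) (y : N) :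
  tens (\sum_(i <- r) F i) y = \sum_(i <- r) tens (F i) y.
Proof.
by have [u uE] := additiveP (@tensBl M N y); rewrite -uE raddf_sum;
  apply: eq_bigr => i _; rewrite uE.
Qed.

Lemma tens_sumr M N (I : Type) (r : seq I) (F : I -> N) (x : M) :
  tens x (\sum_(i <- r) F i) = \sum_(i <- r) tens x (F i).
Proof.
by have [u uE] := additiveP (@tensBr M N x); rewrite -uE raddf_sum;
  apply: eq_bigr => i _; rewrite uE.
Qed.

Lemma tensor_ind M N (S : zgtensor M N -> Prop) :
  subgroup S -> (forall x y, S (tens x y)) -> forall z, S z.
Proof.
move=> gS St; elim/zgquot_ind=> D.
rewrite -(freeg_sumE D) raddf_sum; apply: subgroup_sum => // -[x y].
rewrite -[coeff _ D]intz -freegU_mulz raddfMz.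
by apply: subgroup_mulz => //; apply: St.
Qed.

Lemma tensor_ext M N (V : zmodType) (f f' : {additive zgtensor M N -> V}) :
  (forall x y, f (tens x y) = f' (tens x y)) -> f =1 f'.
Proof.
move=> ff'; apply: tensor_ind ff'.
by split=> [|z z' zE z'E]; rewrite ?raddf0 // !raddfB zE z'E.
Qed.

(** Stated for additive maps so that the non-equivariant [u] of a trace can be tensored as well. *)
Lemma tensor_additive M M' N N' (f : {additive M -> M'}) (g : {additive N -> N'}) :
  exists t : {additive zgtensor M N -> zgtensor M' N'},
    forall x y, t (tens x y) = tens (f x) (g y).
Proof.
pose F := {freeg (M' * N')%type / int}.
have [h hE] : exists h : {additive zgpairs M N -> zgpairs M' N'},
    forall x y, h << (x, y) >> = << (f x, g y) >>.
  have [h hE] := additiveP (lift_is_additive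
    (fun mn : M * N => << (f mn.1, g mn.2) >> : F)).
  by exists h => x y; rewrite hE liftU scale1r.
pose k : {additive zgpairs M N -> zgtensor M' N'} := zgquot_pi _ \o h.
have kU x y : k << (x, y) >> = tens (f x) (g y) by rewrite /= hE.
have k0 D : D \in zgmem (zgpairs_rel M N) -> k D = 0.
  move=> /asboolP/(_ (fun D => k D == 0)) kD; apply/eqP; apply: kD => [|E].
    split=> [|x y]; rewrite !unfold_in ?raddf0 // raddfB.
    by move=> /eqP-> /eqP->; rewrite subr0.
  case=> [[m [m' [n ->]]]|[m [n [n' ->]]]]; rewrite unfold_in !raddfB !kU.
    by rewrite raddfD tensDl addrAC addrK subrr.
  by rewrite raddfD tensDr addrAC addrK subrr.
have [t tE] := zgquot_additive k0.
by exists t => x y; rewrite tE kU.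
Qed.

Lemma tensor_hom M M' N N' (f : zghom M M') (g : zghom N N') :
  exists t : zghom (zgtensor M N) (zgtensor M' N'),
    forall x y, t (tens x y) = tens (f x) (g y).
Proof.
have [t tE'] := tensor_additive f g.
have tE x y : t (tens x y) = tens (f x) (g y) := tE' x y.
have tG h z : t (gact h z) = gact h (t z).
  apply: (@tensor_ext _ _ _ (t \o gact h) (gact h \o t)) => x y.
  rewrite -[LHS]/(t (gact h (tens x y))) -[RHS]/(gact h (t (tens x y))).
  by rewrite tens_act !tE tens_act !zghomG.
by exists (ZGHom (raddfB t) tG).
Qed.

(** For equivariant [g], the trace of [u] tensored with [g] is the trace of [u ⊗ g], because [g] is
    fixed by conjugation. *)
Lemma stable_eq_tensorl M M' N N' (f f' : zghom M M') (g : zghom N N')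
    (t t' : zghom (zgtensor M N) (zgtensor M' N')) :
  (forall x y, t (tens x y) = tens (f x) (g y)) ->
  (forall x y, t' (tens x y) = tens (f' x) (g y)) ->
  stable_eq f f' -> stable_eq t t'.
Proof.
move=> tE t'E /stable_eqP[u uE]; have [v vE] := tensor_additive u g.
apply/stable_eqP; exists v.
apply: (@tensor_ext _ _ _ (zgsubr t t') (zgtr v)) => x y.
rewrite -[LHS]/(t _ - t' _) tE t'E -tensBl uE tens_suml.
apply: eq_bigr => h _.
by rewrite tens_act vE tens_act -zghomG -gactM mulgV gact1.
Qed.

Lemma stable_eq_tensorr M M' N N' (f : zghom M M') (g g' : zghom N N')
    (t t' : zghom (zgtensor M N) (zgtensor M' N')) :
  (forall x y, t (tens x y) = tens (f x) (g y)) ->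
  (forall x y, t' (tens x y) = tens (f x) (g' y)) ->
  stable_eq g g' -> stable_eq t t'.
Proof.
move=> tE t'E /stable_eqP[u uE]; have [v vE] := tensor_additive f u.
apply/stable_eqP; exists v.
apply: (@tensor_ext _ _ _ (zgsubr t t') (zgtr v)) => x y.
rewrite -[LHS]/(t _ - t' _) tE t'E -tensBr uE tens_sumr.
apply: eq_bigr => h _.
by rewrite tens_act vE tens_act -zghomG -gactM mulgV gact1.
Qed.

Lemma stably_isomorphic_tensor M M' N N' :
  stably_isomorphic M M' -> stably_isomorphic N N' ->
  stably_isomorphic (zgtensor M N) (zgtensor M' N').
Proof.
have retract K K' L L' (f : zghom K K') (f' : zghom K' K) (g : zghom L L')
    (g' : zghom L' L) (t : zghom (zgtensor K L) (zgtensor K' L'))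
    (t' : zghom (zgtensor K' L') (zgtensor K L)) :
    (forall x y, t (tens x y) = tens (f x) (g y)) ->
    (forall x y, t' (tens x y) = tens (f' x) (g' y)) ->
    stable_eq (zgcomp f' f) (zgid K) -> stable_eq (zgcomp g' g) (zgid L) ->
    stable_eq (zgcomp t' t) (zgid (zgtensor K L)).
  move=> tE t'E f1 g1.
  (* The two factors are replaced by identities one at a time, through the intermediate map
     [1 ⊗ g'g]. *)
  have [s sE] := tensor_hom (zgid K) (zgcomp g' g).
  apply: (@stable_eq_trans _ _ _ s).
    apply: stable_eq_tensorl _ sE f1 => x y.
    by rewrite -[LHS]/(t' (t (tens x y))) tE t'E.
  exact: stable_eq_tensorr g1.
move=> [f [f' [f1 f'1]]] [g [g' [g1 g'1]]].
have [t tE] := tensor_hom f g; have [t' t'E] := tensor_hom f' g'.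
exists t, t'; split; first exact: retract tE t'E f1 g1.
exact: retract t'E tE f'1 g'1.
Qed.

Lemma finitely_generated_tensor M N : finitely_generated M ->
  finitely_generated N -> finitely_generated (zgtensor M N).
Proof.
move=> [s sP] [t tP]; pose st := [seq tens x y | x <- s, y <- t]; exists st.
have gst := zspan_subgroup st; have [st0 stB] := gst.
apply: tensor_ind => // x y.
have sub0l y' : tens (0 : M) y' = 0 by rewrite -(subrr (0 : M)) tensBl subrr.
have sub0r x' : tens x' (0 : N) = 0 by rewrite -(subrr (0 : N)) tensBr subrr.
apply: (@zspan_min _ s (fun x => zspan st (tens x y))) => // {x} [|x xs].
  by split=> [|x x' ? ?]; rewrite ?sub0l // tensBl; apply: stB.
apply: (@zspan_min _ t (fun y => zspan st (tens x y))) => // {y} [|y yt].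
  by split=> [|y y' ? ?]; rewrite ?sub0r // tensBr; apply: stB.
by apply/zspan_mem/allpairsP; exists (x, y).
Qed.

Lemma stmod_tensor M N : stmod M -> stmod N -> stmod (zgtensor M N).
Proof.
move=> /stmod_isom_fg[M' fgM MM'] /stmod_isom_fg[N' fgN NN'].
have := stably_isomorphic_sym (stably_isomorphic_tensor MM' NN').
by move=> /stmod_isom; apply; apply/finitely_generated_stmod/finitely_generated_tensor.
Qed.

Lemma stably_annihilated_tensor m M N :
  stably_annihilated m M -> stably_annihilated m (zgtensor M N).
Proof.
move=> [phi [phi1 phim]]; have [t tE] := tensor_hom phi (zgid N).
exists t; split; first by apply: stable_eq_tensorl phi1 => x y; rewrite ?tE.
apply: tensor_ind => [|x y].
  split=> [|z z' z0 z0']; first by rewrite raddf0 mul0rn.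
  by rewrite zghomB mulrnBl z0 z0' subr0.
have [u uE] := additiveP (@tensBl M N y).
by rewrite tE -uE -raddfMn phim raddf0.
Qed.

End Tensor.

(** * The chain [D_n] *)

Section Chain.
Local Open Scope ring_scope.
Variable G : finGroupType.
Implicit Types M N : zgmod G.

(** * Trivial modules that separate the [D_n] *)

Lemma ztr_trivial M (u : M -> M) x :
  (forall g (y : M), gact g y = y) -> ztr u x = u x *+ #|G|.
Proof.
move=> trivM; rewrite /ztr; under eq_bigr do rewrite !trivM.
by rewrite sumr_const cardT -cardE.
Qed.

Definition zgtriv_mod (m : nat) : zgmod G := zgquot (zgmultiples m zgtriv).

Lemma stmod_zgtriv : stmod (zgtriv (G := G)).
Proof. exact/finitely_generated_stmod/finitely_generated_int. Qed.

Lemma zgtriv_mod_Dn (p n : nat) : Dn p n (zgtriv_mod (p ^ n)).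
Proof.
apply/DnP; split.
  exact/finitely_generated_stmod/finitely_generated_quot/finitely_generated_int.
exact/annihilated_stably/quot_multiples_annihilated.
Qed.

Variable p : nat.
Hypotheses (p_prime : prime p) (p_dvd : (p %| #|G|)%N).

(** With trivial action, [phi] is the identity plus [|G| u]. Multiplied by [p^n], the second term
    becomes a multiple of [p^(n+1)] and vanishes, so [p^n] would be zero modulo [p^(n+1)]. *)
Lemma zgtriv_mod_notin_Dn n : ~ Dn p n (zgtriv_mod (p ^ n.+1)).
Proof.
move=> /DnP[_ [phi [/stable_eqP[u uE] phi0]]].
set pi := zgquot_pi (zgmultiples (p ^ n.+1) (@zgtriv G)).
have trivM g (y : zgtriv_mod (p ^ n.+1)) : gact g y = y.
  by elim/zgquot_ind: y => x; rewrite -zghomG.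
have := phi0 (pi 1); rewrite -[phi _](subrK (pi 1)) uE ztr_trivial //.
have [k ->] := dvdnP p_dvd.
rewrite mulrnDl -mulrnA -mulnA -expnS mulnC mulrnA.
rewrite quot_multiples_annihilated mul0rn add0r -raddfMn.
move=> /zgquot_pi_eq0/asboolP[y /eqP].
rewrite -mulr_natr -[y *+ _]mulr_natr mul1r !natz => /eqP py.
have : ((p ^ n.+1)%N%:Z %| (p ^ n)%N%:Z)%Z by rewrite py dvdz_mull.
by rewrite dvdzE /= dvdn_Pexp2l ?prime_gt1 // ltnn.
Qed.

(** The integers are torsion-free, so [phi 1 = 0]; then [1 = - |G| u(1)], and [p] would divide
    [1]. *)
Lemma zgtriv_notin_Dn n : ~ Dn p n (zgtriv (G := G)).
Proof.
move=> /DnP[_ [phi [/stable_eqP[u uE] phi0]]].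
have := uE (1 : int); rewrite ztr_trivial //.
have -> : phi (1 : int) = 0.
  have /eqP := phi0 (1 : int); rewrite -mulr_natr mulf_eq0 natz eqz_nat.
  by rewrite expn_eq0 (gtn_eqF (prime_gt0 p_prime)) orbF => /eqP.
rewrite /= sub0r -mulr_natr natz => /eqP; rewrite eqr_oppLR => /eqP p1.
have : (p%:Z %| 1)%Z.
  have -> : 1%Z = - (u 1 * #|G|%:Z) :> int := p1.
  by rewrite dvdzE abszN abszM dvdn_mull.
by rewrite dvdz1; case: (p) p_prime => [|[]].
Qed.

(** * Thickness of the [D_n] and of their union *)

Lemma Dn_leq m n M : (m <= n)%N -> Dn p m M -> Dn p n M.
Proof.
move=> mn /DnP[stM [phi [phi1 phim]]]; apply/DnP; split=> //.
by exists phi; split=> // x; rewrite -(subnKC mn) expnD mulrnA phim mul0rn.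
Qed.

(** Closure under triangles is proved on the Z-split sequence underlying an isomorphic standard
    triangle, then carried back along the stable isomorphisms. *)
Lemma Dn_thick n : thick (Dn (G := G) p n).
Proof.
split.
- by move=> X [].
- by exists (zgtriv_mod (p ^ n)); apply: zgtriv_mod_Dn.
- move=> X Y XY /DnP[stX annX]; apply/DnP; split; first exact: stmod_isom stX.
  exact: stably_annihilated_isom (stably_isomorphic_sym XY) annX.
- move=> X stX; split=> /DnP[_ annX]; apply/DnP; split=> //.
  + exact/stably_annihilated_susp.
  + exact: stmod_susp.
  + exact/stably_annihilated_susp.
- move=> X Y Z f g h stX stY stZ.
  move=> [X' [Y' [Z' [f' [g' [h' [a [b [c [[ex _] [aI bI cI] _]]]]]]]]]].
  have XX' : stably_isomorphic X X' by exists a.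
  have YY' : stably_isomorphic Y Y' by exists b.
  have ZZ' : stably_isomorphic Z Z' by exists c.
  have to N N' : stably_isomorphic N N' ->
      Dn p n N -> stably_annihilated (p ^ n) N'.
    move=> NN' /DnP[_]; apply: stably_annihilated_isom.
    exact: stably_isomorphic_sym.
  split=> [/(to _ _ XX') D1 /(to _ _ YY') D2|/(to _ _ YY') D1 /(to _ _ ZZ') D2
    |/(to _ _ XX') D1 /(to _ _ ZZ') D2]; apply/DnP; split=> //.
  + exact: stably_annihilated_isom ZZ' (stably_annihilated_cone ex D1 D2).
  + exact: stably_annihilated_isom XX' (stably_annihilated_fibre ex D1 D2).
  + exact: stably_annihilated_isom YY' (stably_annihilated_ext ex D1 D2).
- move=> X Y stX _ /DnP[_ /stably_annihilated_fst annX].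
  exact/DnP.
Qed.

Lemma union_Dn_thick : thick (union_Dn (G := G) p).
Proof.
(* Two objects of the union lie in a common [D_n], which reduces the triangle axiom to a single
   [D_n]. *)
have lift2 (X Y : zgmod G) : union_Dn p X -> union_Dn p Y ->
    exists2 n, (1 <= n)%N & Dn p n X /\ Dn p n Y.
  move=> [m m1 DX] [n n1 DY]; exists (maxn m n); first by rewrite leq_max m1.
  by split; [apply: Dn_leq DX; apply: leq_maxl|apply: Dn_leq DY; apply: leq_maxr].
split.
- by move=> X [n _ []].
- by exists (zgtriv_mod (p ^ 1)), 1%N => //; apply: zgtriv_mod_Dn.
- by move=> X Y XY [n n1 DX]; exists n => //; apply: (thick_iso (Dn_thick n)) XY DX.
- move=> X stX.
  by split=> -[n n1 D]; exists n => //; apply/(thick_susp (Dn_thick n) stX).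
- move=> X Y Z f g h stX stY stZ tri.
  split=> D1 D2; have [n n1 [{}D1 {}D2]] := lift2 _ _ D1 D2; exists n => //;
  by have [XY YZ XZ] := thick_triangle (Dn_thick n) stX stY stZ tri; auto.
- move=> X Y stX stY [n n1 D]; exists n => //.
  exact: (thick_summand (Dn_thick n) stX stY D).
Qed.

End Chain.

Theorem proposition7p1 (G : finGroupType) (p : nat)
    (p_prime : prime p) (p_dvd : (p %| #|G|)%N) :
  (forall n : nat, (1 <= n)%N ->
     [/\ thick (Dn (G := G) p n),
         tensor_ideal (Dn (G := G) p n),
         Dn (G := G) p n <> Dn p n.+1,
         (forall M : zgmod G, Dn p n M -> Dn p n.+1 M) &
         (exists M : zgmod G, Dn p n.+1 M /\ ~ Dn p n M)]) /\
  (stmod (zgtriv (G := G)) /\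
   forall n : nat, (1 <= n)%N -> ~ Dn p n (zgtriv (G := G))) /\
  (thick (union_Dn (G := G) p) /\
   exists M : zgmod G, stmod M /\ ~ union_Dn p M).
Proof.
have notZ n : ~ Dn p n (zgtriv (G := G)) by apply: zgtriv_notin_Dn.
split=> [n _|]; last first.
  split; first by split=> [|n _]; [apply: stmod_zgtriv|apply: notZ].
  split; first exact: union_Dn_thick.
  by exists zgtriv; split=> [|[n _ /notZ//]]; apply: stmod_zgtriv.
(* The trivial module [Z/p^(n+1)] witnesses strictness at step [n]. *)
have inD := zgtriv_mod_Dn G p n.+1.
have notD := @zgtriv_mod_notin_Dn G p p_prime p_dvd n.
split.
- exact: Dn_thick.
- move=> M N /DnP[stM annM] stN; apply/DnP; split; first exact: stmod_tensor.
  exact: stably_annihilated_tensor.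
- by move=> DD; apply: notD; rewrite DD.
- by move=> M; apply: Dn_leq.
- by exists (zgtriv_mod G (p ^ n.+1)).
Qed.
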